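(* Let $p\ge 1734097$ be a prime and let $b\in\mathbb{F}_{p^3}$ be such that $\mathrm{Tr}_{p^3/p}(b)\neq 0$. Let $f_b(X)=X+\dfrac{1}{X^p-X+b}$. Then $f_b$ is not a permutation rational function of $\mathbb{F}_{p^3}$; that is, the map $\mathbb{F}_{p^3}\to\mathbb{F}_{p^3}$, $x\mapsto x+(x^p-x+b)^{-1}$, is not a bijection.
   Context: $\mathbb{F}_q$ denotes the finite field with $q$ elements, and $\mathrm{Tr}_{p^n/p}:\mathbb{F}_{p^n}\to\mathbb{F}_p$, $\mathrm{Tr}_{p^n/p}(x)=\sum_{i=0}^{n-1}x^{p^i}$, is the trace. Since $\mathrm{Tr}_{p^3/p}(b)\ne0$ and $\mathrm{Tr}_{p^3/p}(x^p-x)=0$, one has $x^p-x+b\neq 0$ for all $x\in\mathbb{F}_{p^3}$, so $f_b$ defines a map $\mathbb{F}_{p^3}\to\mathbb{F}_{p^3}$. A rational function is called a permutation rational function (PR) of $\mathbb{F}_q$ if it induces a permutation of $\mathbb{F}_q$. *)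

(* Defs.v *)
From mathcomp Require Import all_boot all_order all_algebra.
Set Implicit Arguments.
Unset Strict Implicit.
Unset Printing Implicit Defensive.
Import GRing.Theory.
Local Open Scope ring_scope.

(* Tr_{p^n/p}(x), as an element of the prime subfield of F when #|F| = p ^ n. *)
Definition trace (F : finFieldType) (p n : nat) (x : F) : F :=
  \sum_(i < n) x ^+ (p ^ i).

(* r has no pole on F, and phi is its evaluation map: if r can be written
   with a denominator that does not vanish at x, its value at x does not depend
   on the representation chosen. *)
Definition induces (F : finFieldType) (r : {fraction {poly F}})
    (phi : F -> F) : Prop :=
  exists g h : {poly F},
    [/\ r = tofrac g / tofrac h,
        forall x : F, h.[x] != 0
      & forall x : F, phi x = g.[x] / h.[x]].

Definition permutation_rational_function (F : finFieldType)
    (r : {fraction {poly F}}) : Prop :=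
  exists2 phi : F -> F, induces r phi & bijective phi.

Definition f_b (F : finFieldType) (p : nat) (b : F) : {fraction {poly F}} :=
  tofrac 'X + (tofrac ('X^p - 'X + b%:P))^-1.

(* Main.v *)
Require Import Defs.
From mathcomp Require Import all_boot all_order all_algebra.
From mathcomp Require Import all_solvable all_field.
From mathcomp Require Import ring zify.
Import GRing.Theory.
Local Open Scope ring_scope.

(** Write q = p ^ 3, t = Tr b, and let H be the affine plane of the elements of
    F of trace t.  The denominator A = x^p - x + b takes its values in H and, by
    the additive form of Hilbert 90, takes all of them ([trace_surj]).  With f
    the map in question,

      f(x)^p - f(x) + b = G(A),   where   G(A) = A + A^-p - A^-1.

    Adding an element c of the prime field to x leaves A unchanged and adds c to
    f(x), so that if f is injective then G permutes H ([induced_map_inj]).  Then,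
    for every function P, the sum over A in H of P(G(A)) is the sum of P over H
    ([sum_induced_map]), and it suffices to find power sums that violate this.

    Put u = A^-1, v = u^p and w = v^p.  Sums over H of monomials in u, v, w can
    be computed exactly: the indicator of H is a polynomial in Tr A, and a sum
    of A^n over F is -1 when n is a positive multiple of q - 1 and 0 otherwise.
    Comparing exponents in base p ([base_p_repunit]) leaves one term of the
    trinomial expansion, and for digits l0, l1, l2 < p that are not all zero,
    with M = l0 + l1 + l2, the sum of u^l0 v^l1 w^l2 is t^-M times the trinomial
    coefficient of (l0, l1, l2) if M < p, and is 0 if M >= p ([sum_inv_conj]).
    Positive powers of A are covered too: u^(q-1) = 1 gives
    A = u^(p-2) v^(p-1) w^(p-1), and similarly for A^p and A^(p^2).

    Two test functions are enough.  P(A) = A^2 gives 2 (1 - t^-2) = 0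
    ([sum_square]), so t^2 = 1; P(A) = A (A^p)^2 gives 2 t^-1 + 4 t^-3 = 0
    ([sum_cubic]), so t^2 = -2.  Hence 3 = 0 in F, which is absurd for p > 3. *)

(** * Power sums over a finite field *)

Section PowerSums.

Variable F : finFieldType.

Lemma expf_card_pred (x : F) : x != 0 -> x ^+ #|F|.-1 = 1.
Proof.
move=> x0; apply: (mulfI x0).
by rewrite mulr1 -exprS (ltn_predK (finNzRing_gt1 F)) expf_card.
Qed.

Lemma exists_prim_root_card : exists z : F, #|F|.-1.-primitive_root z.
Proof.
have q_gt1 := finNzRing_gt1 F.
have n0 : (0 < #|F|.-1)%N by rewrite -subn1 subn_gt0.
have un : all #|F|.-1.-unity_root [seq x <- enum F | x != 0].
  apply/allP=> x; rewrite mem_filter => /andP[x0 _].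
  by apply/unity_rootP/expf_card_pred.
have sz : (#|F|.-1 <= size [seq x <- enum F | x != 0%R])%N.
  rewrite size_filter -(leq_add2l (count (pred1 (0 : F)) (enum F))).
  rewrite count_predC -cardE count_uniq_mem ?enum_uniq // mem_enum.
  by rewrite add1n (ltn_predK q_gt1).
have /hasP[z _ zP] := has_prim_root n0 un (filter_uniq _ (enum_uniq _)) sz.
by exists z.
Qed.

(** The translation x |-> x + 1 permutes F, hence preserves the sum of all
    elements. *)
Lemma card_finField_eq0 : #|F|%:R = 0 :> F.
Proof.
have : \sum_(x : F) x = \sum_(x : F) (x + 1).
  by rewrite (reindex_inj (addIr (1 : F))).
rewrite big_split /= sumr_const -[LHS]addr0.
by move/addrI.
Qed.

(** For n not divisible by q - 1, multiplication by a primitive element z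
    permutes F and multiplies the sum by z^n != 1. *)
Lemma sum_expr n : \sum_(x : F) x ^+ n =
  if (0 < n)%N && (#|F|.-1 %| n)%N then -1 else 0.
Proof.
have q_gt1 := finNzRing_gt1 F.
case: posnP => [->|n0] /=.
  under eq_bigr => x _ do rewrite expr0.
  by rewrite sumr_const card_finField_eq0.
case: ifP => [dvd_n|ndvd].
  have Exn x : x != 0 -> x ^+ n = 1 :> F.
    by move=> x0; rewrite -(divnK dvd_n) mulnC exprM expf_card_pred // expr1n.
  rewrite (bigD1 0) //= expr0n gtn_eqF // add0r (eq_bigr _ Exn).
  have := card_finField_eq0; rewrite -sumr_const (bigD1 0) //= => /eqP.
  by rewrite addrC addr_eq0 => /eqP.
have [z zP] := exists_prim_root_card.
have z0 : z != 0.
  apply/eqP => z0; move/eqP: (prim_expr_order zP).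
  by rewrite z0 expr0n gtn_eqF -?subn1 ?subn_gt0 // eq_sym oner_eq0.
have : (z ^+ n - 1) * \sum_(x : F) x ^+ n = 0.
  rewrite mulrBl mul1r mulr_sumr [X in _ - X](reindex_inj (mulfI z0)) /=.
  by under [X in _ - X]eq_bigr => x _ do rewrite exprMn; rewrite subrr.
move/eqP; rewrite mulf_eq0 subr_eq0 -(prim_order_dvd zP) ndvd /=.
by move/eqP.
Qed.

End PowerSums.

(** * Base-p digits *)

(** The lowest digit of a number of the form p b - 1, when carries are bounded
    so that e + 1 < 2 p. *)
Lemma carry_digit (p e a b : nat) : (0 < p)%N -> (e <= 2 * p.-1)%N ->
  (e.+1 + p * a = p * b)%N -> e = p.-1 /\ a.+1 = b.
Proof.
move=> p0 le_e eab.
have /dvdnP[k ek] : (p %| e.+1)%N.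
  by rewrite -(@dvdn_addl (p * a)) ?dvdn_mulr // eab dvdn_mulr.
have k1 : k = 1%N by case: k ek => [|[|k]] // ek; rewrite !mulSn in ek; lia.
rewrite k1 mul1n in ek; split; first by lia.
by move/eqP: eab; rewrite ek -mulnS eqn_pmul2l // => /eqP.
Qed.

(** The bounds allow E to be p^3 - 1 or 2 (p^3 - 1) only; the bound on the digit
    sum excludes the second, whose digits are all 2 (p - 1), and the first has
    the unique expansion found by removing one digit at a time.  Digits up to
    2 (p - 1) occur as sums of two ordinary base-p digits. *)
Lemma base_p_repunit (p e0 e1 e2 : nat) : (1 < p)%N ->
  (e0 <= 2 * p.-1)%N -> (e1 <= 2 * p.-1)%N -> (e2 <= 2 * p.-1)%N ->
  (e0 + e1 + e2 < 6 * p.-1)%N ->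
  let E := (e0 + p * (e1 + p * e2))%N in
  (0 < E)%N && ((p ^ 3).-1 %| E)%N = [&& e0 == p.-1, e1 == p.-1 & e2 == p.-1].
Proof.
move=> p1 le0 le1 le2 lts /=.
have [n pn] : exists n, p = n.+2 by exists p.-2; lia.
have p3 : ((p ^ 3).-1 = p.-1 * (1 + p * (1 + p)))%N.
  by rewrite pn !expnS expn0 /=; lia.
apply/idP/and3P => [/andP[E0 /dvdnP[k Ek]]|[/eqP-> /eqP-> /eqP->]]; last first.
  rewrite p3; apply/andP; split; first by lia.
  by apply/dvdnP; exists 1%N; lia.
have k1 : k = 1%N.
  have ltE : (e0 + p * (e1 + p * e2) < 2 * (p ^ 3).-1)%N.
    rewrite p3.
    have p0 := ltnW p1.
    have [/eqP e1E|lt1] := boolP (e1 == 2 * p.-1)%N; last first.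
      have : (p * e1 < p * (2 * p.-1))%N.
        by rewrite ltn_pmul2l // ltn_neqAle lt1.
      have : (p * (p * e2) <= p * (p * (2 * p.-1)))%N by rewrite !leq_pmul2l.
      by rewrite !mulnDr !mulnA; lia.
    have [/eqP e2E|lt2] := boolP (e2 == 2 * p.-1)%N; last first.
      have : (p * (p * e2) < p * (p * (2 * p.-1)))%N.
        by rewrite !ltn_pmul2l // ltn_neqAle lt2.
      by rewrite e1E !mulnDr !mulnA; lia.
    by rewrite e1E e2E in lts *; rewrite !mulnDr !mulnA; lia.
  move: E0 ltE; rewrite Ek muln_gt0 ltn_mul2r.
  by case: k {Ek} => [|[|k]] //; rewrite !andbF.
move: Ek; rewrite k1 mul1n => Ek.
have p30 : (0 < p ^ 3)%N by rewrite expn_gt0 (ltnW p1).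
have := @carry_digit p e0 (e1 + p * e2) (p * p) (ltnW p1) le0.
case; first by rewrite addSn Ek prednK // !expnS expn0 muln1.
move=> -> Ek1.
have := @carry_digit p e1 e2 p (ltnW p1) le1.
case; first by rewrite addSn.
by move=> -> <-.
Qed.

(** * Sums over the elements of a given trace *)

Section CubicExtension.

Variables (p : nat) (F : finFieldType).
Hypotheses (p_prime : prime p) (cardF : #|F| = (p ^ 3)%N).

Let p_gt1 : (1 < p)%N := prime_gt1 p_prime.
Let p_gt0 : (0 < p)%N := prime_gt0 p_prime.

Lemma pcharFp : p \in [pchar F].
Proof. exact: card_finPcharP cardF p_prime. Qed.

Lemma frobD (x y : F) : (x + y) ^+ p = x ^+ p + y ^+ p.
Proof. by rewrite exprDn_pchar // pnatE // pcharFp. Qed.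

Lemma frob0 : 0 ^+ p = 0 :> F.
Proof. by rewrite expr0n gtn_eqF. Qed.

Lemma frobN (x : F) : (- x) ^+ p = - x ^+ p.
Proof. by apply/eqP; rewrite -addr_eq0 -frobD addNr frob0. Qed.

Lemma frob3 (x : F) : x ^+ p ^+ p ^+ p = x.
Proof. by rewrite -!exprM -[RHS]expf_card cardF. Qed.

Lemma traceE (x : F) : trace p 3 x = x + x ^+ p + x ^+ p ^+ p.
Proof.
by rewrite /trace !big_ord_recr big_ord0 /= add0r expn0 expn1 expr1 -exprM.
Qed.

Lemma trace0 : trace p 3 (0 : F) = 0.
Proof. by rewrite traceE !frob0 !addr0. Qed.

Lemma frob_trace (x : F) : trace p 3 x ^+ p = trace p 3 x.
Proof. by rewrite traceE !frobD frob3; ring. Qed.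

Lemma trace_neq0 (t x : F) : t != 0 -> trace p 3 x == t -> x != 0.
Proof.
by move=> t0 /eqP xt; apply: contra_neq t0 => x0; rewrite -xt x0 trace0.
Qed.

(** From t^p - y^p = (t - y) S, where S is the sum on the
    right: for y and t fixed by Frobenius, t^p - y^p is t - y, so S = 1 if
    y != t, while S = p t^(p-1) = 0 if y = t. *)
Lemma eq_prime_subfield (y t : F) : y ^+ p = y -> t ^+ p = t ->
  (y == t)%:R = 1 - \sum_(m < p) t ^+ (p.-1 - m) * y ^+ m.
Proof.
move=> yp tp; case: eqP => [->|/eqP yt].
  under eq_bigr => m _ do rewrite -exprD subnK -1?ltnS ?prednK //.
  by rewrite sumr_const card_ord -(mulr_natr _ p) (pcharf0 pcharFp) mulr0 subr0.
have := subrXX t y p; rewrite tp yp -{1}[t - y]mulr1.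
have ty0 : t - y != 0 by rewrite subr_eq0 eq_sym.
by move/(mulfI ty0) => <-; rewrite subrr.
Qed.

Section Digits.

Variables l0 l1 l2 : nat.
Hypotheses (l0p : (l0 < p)%N) (l1p : (l1 < p)%N) (l2p : (l2 < p)%N).

(* x^N is x^-(l0 + l1 p + l2 p^2) for x != 0, written with a nonnegative
   exponent. *)
Let N := (p.-1 - l0 + p * (p.-1 - l1 + p * (p.-1 - l2)))%N.
Let M := (l0 + l1 + l2)%N.

Lemma sum_expr_conj e0 e1 e2 : (e0 + e1 + e2 < p)%N ->
  \sum_(x : F) x ^+ N * (x ^+ e0 * (x ^+ p ^+ e1 * x ^+ p ^+ p ^+ e2)) =
  if [&& e0 == l0, e1 == l1 & e2 == l2] then -1 else 0.
Proof.
move=> lte.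
under eq_bigr => x _ do rewrite -!exprM -!exprD.
rewrite sum_expr cardF.
have -> : (N + (e0 + (p * e1 + p * (p * e2))) =
    p.-1 - l0 + e0 + p * (p.-1 - l1 + e1 + p * (p.-1 - l2 + e2)))%N.
  by rewrite /N !mulnDr !mulnA; lia.
rewrite base_p_repunit //; try lia.
suff -> : [&& (p.-1 - l0 + e0)%N == p.-1, (p.-1 - l1 + e1)%N == p.-1
  & (p.-1 - l2 + e2)%N == p.-1] = [&& e0 == l0, e1 == l1 & e2 == l2] by [].
by lia.
Qed.

(** In the trinomial expansion of (x + x^p + x^(p^2))^m, the term with exponents
    (m - i, i - j, j) survives summation over F only for (l0, l1, l2). *)
Lemma sum_expr_trace m : (m < p)%N ->
  \sum_(x : F) x ^+ N * trace p 3 x ^+ m =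
  if m == M then - ('C(M, l1 + l2) * 'C(l1 + l2, l2))%:R else 0.
Proof.
move=> mp.
transitivity (\sum_(i < m.+1) \sum_(j < i.+1)
   (if [&& m - i == l0, i - j == l1 & (j : nat) == l2]%N then -1 else 0 : F)
     *+ ('C(m, i) * 'C(i, j))).
  under eq_bigr => x _.
    rewrite traceE -addrA exprDn mulr_sumr.
    under eq_bigr => i _.
      rewrite exprDn mulr_sumr -sumrMnl mulr_sumr.
      over.
    over.
  rewrite exchange_big /=; apply: eq_bigr => i _.
  rewrite exchange_big /=; apply: eq_bigr => j _.
  rewrite -sum_expr_conj ?sumrMnl; last first.
    by have := ltn_ord i; have := ltn_ord j; lia.
  by rewrite -sumrMnl; apply: eq_bigr => x _; rewrite -!mulrnAr -mulrnA mulnC.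
case: eqP => [mM|mM]; last first.
  rewrite big1 // => i _; rewrite big1 // => j _.
  case: ifP => [|_]; rewrite ?mul0rn //.
  by have := ltn_ord i; have := ltn_ord j; lia.
have im : (l1 + l2 < m.+1)%N by lia.
rewrite (bigD1 (Ordinal im)) //= [X in _ + X]big1 ?addr0; last first.
  move=> i /eqP/val_eqP/= ni; rewrite big1 // => j _.
  case: ifP => [|_]; rewrite ?mul0rn //.
  by have := ltn_ord i; have := ltn_ord j; lia.
have jm : (l2 < (l1 + l2).+1)%N by lia.
rewrite (bigD1 (Ordinal jm)) //= [X in _ + X]big1 ?addr0; last first.
  move=> j /eqP/val_eqP/= nj.
  by case: ifP => [|_]; rewrite ?mul0rn //; lia.
rewrite ifT; last by lia.
by rewrite mM mulNrn.
Qed.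

(** Multiplying x^N by the indicator of the condition Tr x = t, written as a
    polynomial in Tr x, reduces this to [sum_expr_trace]: only the power
    (Tr x)^M can contribute, and it occurs in the indicator exactly when M < p.
    The coefficient t^(p-1-M) equals t^-M because t lies in the prime field. *)
Lemma sum_inv_conj (t : F) : t != 0 -> t ^+ p = t -> (0 < M)%N ->
  \sum_(x : F | trace p 3 x == t)
     x^-1 ^+ l0 * x^-1 ^+ p ^+ l1 * x^-1 ^+ p ^+ p ^+ l2 =
  if (M < p)%N then t ^- M * ('C(M, l1 + l2) * 'C(l1 + l2, l2))%:R else 0.
Proof.
move=> t0 tp M0.
transitivity (\sum_(x : F) x ^+ N * (trace p 3 x == t)%:R).
  rewrite big_mkcond; apply: eq_bigr => x _.
  case: ifP => [/(trace_neq0 _ _ t0) x0|_]; rewrite ?mulr0 ?mulr1 //.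
  set L := (l0 + p * (l1 + p * l2))%N.
  have -> : x^-1 ^+ l0 * x^-1 ^+ p ^+ l1 * x^-1 ^+ p ^+ p ^+ l2 = x ^- L.
    by rewrite -!exprM -!exprD exprVn /L mulnDr mulnA addnA.
  apply: (mulfI (expf_neq0 L x0)); rewrite divff ?expf_neq0 // -exprD.
  have -> : (L + N = #|F|.-1)%N.
    have -> : (L + N = (l0 + (p.-1 - l0)) +
        p * ((l1 + (p.-1 - l1)) + p * (l2 + (p.-1 - l2))))%N.
      by rewrite /L /N !mulnDr !mulnA; lia.
    have cpl l : (l < p)%N -> (l + (p.-1 - l) = p.-1)%N by lia.
    rewrite !cpl // cardF.
    have [n ->] : exists n, p = n.+1 by exists p.-1; lia.
    by rewrite !expnS expn0 /=; lia.
  by rewrite expf_card_pred.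
under eq_bigr => x _.
  rewrite eq_prime_subfield ?frob_trace // mulrBr mulr1 mulr_sumr.
  over.
rewrite sumrB.
have -> : \sum_(x : F) x ^+ N = 0.
  have := sum_expr_conj 0 0 0 p_gt0.
  under eq_bigr => x _ do rewrite !expr0 !mulr1.
  by move->; rewrite ifF //; lia.
rewrite sub0r exchange_big /=.
under eq_bigr => m _.
  under eq_bigr => x _ do rewrite mulrCA.
  rewrite -mulr_sumr sum_expr_trace //.
  over.
case: ltnP => [Mp|pM].
  rewrite (bigD1 (Ordinal Mp)) //= [X in _ + X]big1 ?addr0; last first.
    by move=> m /eqP/val_eqP/= /negPf->; rewrite mulr0.
  rewrite eqxx mulrN opprK; congr (_ * _).
  apply: (mulfI (expf_neq0 M t0)); rewrite divff ?expf_neq0 // -exprD.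
  rewrite subnKC; last by lia.
  by apply: (mulfI t0); rewrite mulr1 -exprS prednK.
rewrite big1 ?oppr0 // => m _; rewrite ifF ?mulr0 //.
by have := ltn_ord m; lia.
Qed.

End Digits.

(** * Reduction to a permutation of the plane of trace t *)

Section Reduction.

Variable b : F.
Hypothesis trb : trace p 3 b != 0.

Let t := trace p 3 b.

Lemma trace_denominator (x : F) : trace p 3 (x ^+ p - x + b) = t.
Proof. by rewrite /t !traceE !(frobD, frobN) frob3; ring. Qed.

Lemma denominator_neq0 (x : F) : x ^+ p - x + b != 0.
Proof.
by apply: (trace_neq0 _ _ trb); apply/eqP/trace_denominator.
Qed.

(** Additive Hilbert 90 in degree 3.  The solution of x^p - x = z, for z of
    trace 0, is Hilbert's explicit one, with b as the element of nonzero
    trace. *)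
Lemma trace_surj (a : F) : trace p 3 a = t -> exists x, x ^+ p - x + b = a.
Proof.
have [z ->] : exists z, a = z + b by exists (a - b); rewrite subrK.
move=> tzb; have tz : z + z ^+ p + z ^+ p ^+ p = 0.
  apply: (addIr t); rewrite add0r -[RHS]tzb /t !traceE !frobD; ring.
exists (- (z * b ^+ p + (z + z ^+ p) * b ^+ p ^+ p) / t).
have tp : t ^+ p = t by rewrite frob_trace.
rewrite exprMn exprVn tp frobN.
rewrite frobD !exprMn frobD frob3.
have -> : z ^+ p ^+ p = - z - z ^+ p.
  by apply/eqP; rewrite -subr_eq0 -tz; apply/eqP; ring.
have tE : t = b + b ^+ p + b ^+ p ^+ p by rewrite /t traceE.
congr (_ + _); apply: (mulIf trb); rewrite -/t mulrBl !mulfVK //.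
by rewrite tE; ring.
Qed.

(** What x |-> x + (x^p - x + b)^-1 becomes in the coordinate x^p - x + b: see
    [induced_map_denominator]. *)
Definition induced_map (x : F) := x + x^-1 ^+ p - x^-1.

Lemma trace_induced_map x : trace p 3 (induced_map x) = trace p 3 x.
Proof. by rewrite !traceE /induced_map !(frobD, frobN) frob3; ring. Qed.

Lemma induced_map_denominator x : let f y := y + (y ^+ p - y + b)^-1 in
  induced_map (x ^+ p - x + b) = f x ^+ p - f x + b.
Proof. by rewrite /induced_map /= frobD; ring. Qed.

Hypothesis f_inj : injective (fun x : F => x + (x ^+ p - x + b)^-1).

Lemma induced_map_inj :
  {in [set x | trace p 3 x == t] &, injective induced_map}.
Proof.
move=> a1 a2; rewrite !inE => /eqP/trace_surj[x <-] /eqP/trace_surj[y <-].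
rewrite !induced_map_denominator => /addIr fxy.
pose f (z : F) := z + (z ^+ p - z + b)^-1; rewrite -/(f x) -/(f y) in fxy.
(* f x and f y differ by c in the prime field, and f commutes with
   translations by the prime field, so f (y + c) = f y + c = f x. *)
pose c := f x - f y.
have cp : c ^+ p = c.
  have -> : c ^+ p = f x ^+ p - f y ^+ p by rewrite /c frobD frobN.
  have -> : f x ^+ p = f y ^+ p - f y + f x by rewrite -fxy subrK.
  by rewrite /c; ring.
have dc : (y + c) ^+ p - (y + c) = y ^+ p - y by rewrite frobD cp; ring.
have <- : y + c = x; last by rewrite dc.
by apply: f_inj; rewrite /= dc /c {1}/f; rewrite /f; ring.
Qed.

(** An injective self-map of the finite plane of trace t permutes it. *)
Lemma sum_induced_map (P : F -> F) :
  \sum_(x | trace p 3 x == t) P (induced_map x) =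
  \sum_(x | trace p 3 x == t) P x.
Proof.
pose H := [set x | trace p 3 x == t].
have imH : [set induced_map x | x in H] = H.
  apply/eqP; rewrite eqEcard (card_in_imset induced_map_inj) leqnn andbT.
  by apply/subsetP=> _ /imsetP[x + ->]; rewrite !inE trace_induced_map.
have HE Q : \sum_(x | trace p 3 x == t) Q x = \sum_(x in H) Q x :> F.
  by apply: eq_bigl => x; rewrite inE.
by rewrite !HE -{2}imH (big_imset _ induced_map_inj).
Qed.

End Reduction.

(** * Two power sums of the induced map *)

Section Moments.

Variable t : F.
Hypotheses (p_gt3 : (3 < p)%N) (t_neq0 : t != 0) (frob_t : t ^+ p = t).

Definition inv_monomial l0 l1 l2 (x : F) :=
  x^-1 ^+ l0 * x^-1 ^+ p ^+ l1 * x^-1 ^+ p ^+ p ^+ l2.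

Definition moment l0 l1 l2 :=
  \sum_(x | trace p 3 x == t) inv_monomial l0 l1 l2 x.

Lemma moment_small l0 l1 l2 m c : (l0 + l1 + l2)%N = m ->
  ('C(l0 + l1 + l2, l1 + l2) * 'C(l1 + l2, l2))%N = c ->
  (0 < m < p)%N -> moment l0 l1 l2 = t ^- m * c%:R.
Proof.
move=> <- <- /andP[l_gt0 l_ltp].
by rewrite /moment /inv_monomial sum_inv_conj ?l_ltp //; lia.
Qed.

Lemma moment_large l0 l1 l2 : (l0 < p)%N -> (l1 < p)%N -> (l2 < p)%N ->
  (p <= l0 + l1 + l2)%N -> moment l0 l1 l2 = 0.
Proof.
move=> *; rewrite /moment /inv_monomial sum_inv_conj //; last by lia.
by rewrite ltnNge ifF //; lia.
Qed.

(** The sum of x / x^p, as u^(p-1) = v / u with u = x^-1 and v = u^p; it is the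
    source of the constant term in [sum_square]. *)
Lemma moment_pred : moment p.-1 0 0 = 1.
Proof.
rewrite (@moment_small _ _ _ p.-1 1%N) ?addn0 ?bin0 ?mulr1; try lia.
apply: (mulfI (expf_neq0 p.-1 t_neq0)); rewrite divff ?expf_neq0 // mulr1.
by apply: (mulfI t_neq0); rewrite mulr1 -exprS prednK //; lia.
Qed.

(** Frobenius permutes u, v, w cyclically; this rewrites the large powers in the
    moments as Laurent monomials in u, v, w, so that identities between them
    become identities of rational functions. *)
Lemma inv_conj_powers (x : F) : x != 0 ->
  let u := x^-1 in let v := u ^+ p in let w := v ^+ p in
  [/\ [/\ u != 0, v != 0 & w != 0], x = u^-1 /\ x ^+ p = v^-1,
      [/\ u ^+ p.-1 = v / u, v ^+ p.-1 = w / v & w ^+ p.-1 = u / w]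
    & u ^+ p.-2 = v / u ^+ 2 /\ v ^+ p.-2 = w / v ^+ 2].
Proof.
move=> x0 /=.
have w3 := frob3 x^-1.
have u0 : x^-1 != 0 by rewrite invr_eq0.
set u := x^-1 in u0 *.
have v0 : u ^+ p != 0 by rewrite expf_neq0.
have w0 : u ^+ p ^+ p != 0 by rewrite expf_neq0.
have pred1 (y : F) : y != 0 -> y ^+ p.-1 = y ^+ p / y.
  by move=> y0; apply: (mulIf y0); rewrite mulfVK // -exprSr prednK //; lia.
have pred2 (y : F) : y != 0 -> y ^+ p.-2 = y ^+ p / y ^+ 2.
  move=> y0; apply: (mulIf (expf_neq0 2 y0)).
  rewrite mulfVK ?expf_neq0 // -exprD; congr (_ ^+ _); lia.
split=> //; first by rewrite /u exprVn !invrK.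
  by rewrite !pred1 // w3.
by rewrite !pred2.
Qed.

(** The digits (0, 0, 0) and (p - 1, p - 1, p - 1) define the same function on
    nonzero elements, and the second are covered by the vanishing range. *)
Lemma moment0 : moment 0 0 0 = 0.
Proof.
rewrite -(moment_large p.-1 p.-1 p.-1); try lia.
apply: eq_bigr => x /(trace_neq0 _ _ t_neq0) /inv_conj_powers[].
rewrite /inv_monomial !expr0.
set u := x^-1; set v := u ^+ p; set w := v ^+ p.
by move=> [u0 v0 w0] _ [-> -> ->] _; field; rewrite u0 v0 w0.
Qed.

Local Notation G := induced_map.

(** With u = x^-1, v = u^p the square of G x = u^-1 + v - u expands as
    u^-2 + v^2 + u^2 + 2 v/u - 2 - 2 u v, where v/u = u^(p-1). *)
Lemma sum_square :
  \sum_(x | trace p 3 x == t) (G x ^+ 2 - x ^+ 2) = 2 * (1 - t ^- 2).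
Proof.
transitivity (moment 0 2 0 + moment 2 0 0 + 2 * moment p.-1 0 0
   - 2 * moment 0 0 0 - 2 * moment 1 1 0).
  rewrite /moment !mulr_sumr -!sumrN -!big_split /=.
  apply: eq_bigr => x /(trace_neq0 _ _ t_neq0) /inv_conj_powers[].
  rewrite /induced_map /inv_monomial.
  set u := x^-1; set v := u ^+ p; set w := v ^+ p.
  move=> [u0 v0 w0] [-> _] [-> _ _] _; field; exact: u0.
have small m : (0 < m <= 3)%N -> (0 < m < p)%N by lia.
rewrite moment0 moment_pred (@moment_small 0 2 0 2 1) ?small //.
rewrite (@moment_small 2 0 0 2 1) ?(@moment_small 1 1 0 2 2) ?small //.
by field.
Qed.

(** Expand (u^-1 + v - u) (v^-1 + w - v)^2.  Apart from u^-1 v^-2, which is the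
    subtracted term, every monomial with a negative power of u or v left after
    cancellation has, once rewritten with digits between 0 and p - 1, a digit
    sum of at least p.  Only the monomials of degree 1 and 3 contribute. *)
Lemma sum_cubic :
  \sum_(x | trace p 3 x == t) (G x * G x ^+ p ^+ 2 - x * x ^+ p ^+ 2) =
  2 * t^-1 + 4 * t ^- 3.
Proof.
transitivity (moment p.-1 p.-1 1 + moment p.-1 1 0 + 2 * moment p.-1 p.-2 0
  - 2 * moment p.-2 p.-1 p.-1 - 2 * moment p.-1 0 1 + moment p.-1 p.-2 p.-1
  + moment 0 1 2 + moment 0 3 0 + 2 * moment 0 0 1 - 2 * moment 0 1 0
  - 2 * moment 0 2 1 - moment 0 p.-2 p.-1 - moment 1 0 2 - moment 1 2 0
  - 2 * moment 1 p.-1 0 + 2 * moment 1 0 0 + 2 * moment 1 1 1).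
  rewrite /moment !mulr_sumr -!sumrN -!big_split /=.
  apply: eq_bigr => x /(trace_neq0 _ _ t_neq0) /inv_conj_powers[].
  rewrite /induced_map /inv_monomial.
  rewrite frobD // frobD // frobN //.
  set u := x^-1; set v := u ^+ p; set w := v ^+ p.
  move=> [u0 v0 w0] [xu xv] [-> -> ->] [-> ->].
  by rewrite xv xu; field; rewrite u0 v0 w0.
rewrite (@moment_large p.-1 p.-1 1) ?(@moment_large p.-1 1 0); try lia.
rewrite (@moment_large p.-1 p.-2 0) ?(@moment_large p.-2 p.-1 p.-1); try lia.
rewrite (@moment_large p.-1 0 1) ?(@moment_large p.-1 p.-2 p.-1); try lia.
rewrite (@moment_large 0 p.-2 p.-1) ?(@moment_large 1 p.-1 0); try lia.
have small m : (0 < m <= 3)%N -> (0 < m < p)%N by lia.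
rewrite (@moment_small 0 1 2 3 3) ?(@moment_small 0 3 0 3 1) ?small //.
rewrite (@moment_small 0 0 1 1 1) ?(@moment_small 0 1 0 1 1) ?small //.
rewrite (@moment_small 0 2 1 3 3) ?(@moment_small 1 0 2 3 3) ?small //.
rewrite (@moment_small 1 2 0 3 3) ?(@moment_small 1 1 1 3 6) ?small //.
rewrite (@moment_small 1 0 0 1 1) ?small //.
by field.
Qed.

End Moments.

End CubicExtension.

(** * Rational functions and the maps they induce *)

(** Clearing denominators turns the equality of fractions into one of
    polynomials, which can be evaluated at every point because neither
    denominator has a root. *)
Lemma induces_f_b (p : nat) (F : finFieldType) (b : F) (phi : F -> F) :
  (forall x : F, x ^+ p - x + b != 0) -> induces (f_b p b) phi ->
  phi =1 (fun x => x + (x ^+ p - x + b)^-1).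
Proof.
move=> d_neq0 [g [h [fE h_neq0 phiE]]] x; rewrite phiE.
have clear_den (K : fieldType) (y c e : K) : c != 0 ->
    (y * c + 1) * e = (y + c^-1) * e * c by move=> c0; field.
pose d : {poly F} := 'X^p - 'X + b%:P.
have dE (y : F) : d.[y] = y ^+ p - y + b by rewrite !hornerE.
move: fE; rewrite /f_b -/d; clearbody d => fE.
have d0 : d != 0 by apply: contra_neq (d_neq0 x) => d0; rewrite -dE d0 horner0.
have h0 : h != 0 by apply: contra_neq (h_neq0 x) => ->; rewrite horner0.
have /eqP : tofrac (('X * d + 1) * h) = tofrac (g * d).
  have dF0 : tofrac d != 0 by rewrite tofrac_eq0.
  have hF0 : tofrac h != 0 by rewrite tofrac_eq0.
  rewrite !tofracM tofracD tofracM tofrac1.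
  have -> : tofrac g = (tofrac 'X + (tofrac d)^-1) * tofrac h.
    by rewrite fE divfK.
  move: dF0; move: (tofrac 'X) (tofrac d) (tofrac h) => y c e.
  exact: clear_den.
rewrite tofrac_eq => /eqP/(congr1 (fun r : {poly F} => r.[x])).
rewrite !hornerE dE => E.
apply: (mulIf (h_neq0 x)); rewrite divfK //.
by apply: (mulIf (d_neq0 x)); rewrite -E clear_den.
Qed.

Lemma shifted_inverse_not_injective (p : nat) (F : finFieldType) (b : F) :
  prime p -> (3 < p)%N -> #|F| = (p ^ 3)%N -> trace p 3 b != 0 ->
  ~ injective (fun x : F => x + (x ^+ p - x + b)^-1).
Proof.
move=> p_prime p_gt3 cardF trb f_inj.
set t := trace p 3 b in trb.
have tp : t ^+ p = t by apply: frob_trace p_prime cardF b.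
have sumG := sum_induced_map p F p_prime cardF b trb f_inj.
have := sum_square p F p_prime cardF t p_gt3 trb tp.
rewrite sumrB (sumG (fun y => y ^+ 2)) subrr => E2.
have := sum_cubic p F p_prime cardF t p_gt3 trb tp.
rewrite sumrB (sumG (fun y => y * y ^+ p ^+ 2)) subrr => E3.
have natr_neq0 n : (0 < n < p)%N -> n%:R != 0 :> F.
  move=> n_lt; rewrite -(dvdn_pcharf (pcharFp p F p_prime cardF)).
  by apply/negP => /dvdn_leq; lia.
have t2 : t ^- 2 = 1.
  have n2 : 2 != 0 :> F by rewrite natr_neq0 //; lia.
  by move/esym/eqP: E2; rewrite mulf_eq0 (negPf n2) subr_eq0 eq_sym => /eqP.
have : (2 * 3 * t^-1) != 0.
  by rewrite !mulf_neq0 ?invr_eq0 // natr_neq0 //; lia.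
rewrite (_ : 2 * 3 * t^-1 = 2 * t^-1 + 4 * (t ^- 2 * t^-1)); last first.
  by rewrite t2; ring.
by rewrite -exprVn -exprSr exprVn -E3 eqxx.
Qed.

Theorem theorem3p1 (p : nat) (F : finFieldType) (b : F)
    (p_prime : prime p) (p_large : (1734097 <= p)%N)
    (cardF : #|F| = (p ^ 3)%N) (trb : trace p 3 b != 0) :
  ~ permutation_rational_function (f_b p b) /\
  ~ bijective (fun x : F => x + (x ^+ p - x + b)^-1).
Proof.
have p_gt3 : (3 < p)%N by apply: leq_trans p_large.
have f_ninj := shifted_inverse_not_injective p F b p_prime p_gt3 cardF trb.
split=> [[phi phi_f phi_bij]|/bij_inj]; last exact: f_ninj.
apply/f_ninj/(eq_inj (bij_inj phi_bij))/induces_f_b; last exact: phi_f.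
by move=> x; apply: denominator_neq0.
Qed.
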